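(* Let $n\ge 2$ be an integer. The map $$d_V(z_1,\ldots,z_n)=\prod_{1\le i<j\le n}|z_i-z_j|,\qquad z_1,\ldots,z_n\in\mathbb{C},$$ (that is, $d_V=|V|$ where $V(z_1,\ldots,z_n)=\prod_{1\le i<j\le n}(z_i-z_j)$ is the Vandermonde determinant) is an $n$-metric on $\mathbb{C}$, and its restriction to $\mathbb{R}^n$ is an $n$-metric on $\mathbb{R}$.
   Context: Let $n\ge 2$ and let $X$ be a set. A map $d:X^n\to\mathbb{R}$ is a pseudo $n$-metric on $X$ if: (i) (semidefiniteness) $d(x_1,\ldots,x_n)=0$ whenever $x_i=x_j$ for some $i\ne j$; (ii) (symmetry) $d(x_{\pi(1)},\ldots,x_{\pi(n)})=d(x_1,\ldots,x_n)$ for all $x_1,\ldots,x_n\in X$ and all permutations $\pi$ of $\{1,\ldots,n\}$; (iii) (simplicial inequality) $d(x_1,\ldots,x_n)\le\sum_{i=1}^n d(x_1,\ldots,x_{i-1},y,x_{i+1},\ldots,x_n)$ for all $x_1,\ldots,x_n,y\in X$. A pseudo $n$-metric is called an $n$-metric if moreover $d(x_1,\ldots,x_n)=0$ implies $x_i=x_j$ for some $i\ne j$. *)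

(* Defs.v *)
From mathcomp Require Import all_boot all_order all_algebra all_fingroup.
From mathcomp Require Import reals.
From mathcomp.real_closed Require Import complex.

Set Implicit Arguments.
Unset Strict Implicit.
Unset Printing Implicit Defensive.

Import Order.TTheory GRing.Theory Num.Theory.

Local Open Scope ring_scope.
Local Open Scope complex_scope.

(* Points of X^n are finite functions, [(X ^ n)%type = {ffun 'I_n -> X}]. *)

Definition replace_at (X : Type) (n : nat) (x : (X ^ n)%type) (i : 'I_n)
    (y : X) : (X ^ n)%type :=
  [ffun k => if k == i then y else x k].

Record pseudo_nmetric (R : realType) (X : Type) (n : nat)
    (d : (X ^ n)%type -> R) : Prop := PseudoNMetric {
  nmetric_semidefinite : forall (x : (X ^ n)%type) (i j : 'I_n),
    i <> j -> x i = x j -> d x = 0;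
  nmetric_symmetric : forall (x : (X ^ n)%type) (s : 'S_n),
    d [ffun k => x (s k)] = d x;
  nmetric_simplicial : forall (x : (X ^ n)%type) (y : X),
    d x <= \sum_(i < n) d (replace_at x i y)
}.

Record nmetric (R : realType) (X : Type) (n : nat)
    (d : (X ^ n)%type -> R) : Prop := NMetric {
  nmetric_pseudo : pseudo_nmetric d;
  nmetric_definite : forall x : (X ^ n)%type,
    d x = 0 -> exists i j : 'I_n, i <> j /\ x i = x j
}.

(* [normc] is the real-valued modulus; the norm [`|z|] of [z : R[i]] in the
   numeric field structure takes its values in [R[i]]. *)
Definition dV (R : realType) (n : nat) (z : (R[i] ^ n)%type) : R :=
  \prod_(i < n) \prod_(j < n | (i < j)%N) ComplexField.Normc.normc (z i - z j).

(* This is the determinant of the library's [Vandermonde] matrix only up to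
   sign, the factors there being [z j - z i]. *)
Definition vandermonde (R : realType) (n : nat) (z : (R[i] ^ n)%type) : R[i] :=
  \prod_(i < n) \prod_(j < n | (i < j)%N) (z i - z j).

Definition real_restriction (R : realType) (n : nat)
    (d : (R[i] ^ n)%type -> R) (x : (R ^ n)%type) : R :=
  d [ffun k => (x k)%:C].

(* Main.v *)
Require Import Defs.
From mathcomp Require Import all_boot all_order all_algebra all_fingroup.
From mathcomp Require Import reals.
From mathcomp.real_closed Require Import complex.

Set Implicit Arguments.
Unset Strict Implicit.
Unset Printing Implicit Defensive.

(** The matrix [A] with rows [(1, z_i, .., z_i ^ (n-1))] has determinant
    [V(z)] up to sign, and [V] with [z_i] replaced by [y] is, up to the same
    sign, the determinant of [A] with row [i] replaced by
    [b = (1, y, .., y ^ (n-1))].  By Cramer's rule these determinants are the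
    entries of [b *m \adj A]; since the first column of [A] is constantly
    [1 = b_0], their sum is the first entry of [b *m \adj A *m A = \det A *: b],
    that is [\det A].  So the sum of the [V(z_1, .., y, .., z_n)] is exactly
    [V(z)], and the simplicial inequality is the triangle inequality. *)

Local Open Scope ring_scope.
Local Open Scope complex_scope.

Import Order.TTheory GRing.Theory Num.Theory ComplexField.Normc.

Lemma sum_det_replace_row (R : comNzRingType) (n : nat) (A : 'M[R]_n)
    (b : 'rV[R]_n) (j0 : 'I_n) :
  b 0 j0 = 1 -> (forall i, A i j0 = 1) ->
  \sum_i \det (\matrix_(k, j) if k == i then b 0 j else A k j) = \det A.
Proof.
move=> b1 A1.
transitivity ((b *m \adj A *m A) 0 j0); last first.
  by rewrite -mulmxA mul_adj_mx mul_mx_scalar mxE b1 mulr1.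
rewrite [RHS]mxE; apply: eq_bigr => i _.
rewrite A1 mulr1 mxE (expand_det_row _ i).
apply: eq_bigr => j _; rewrite !mxE eqxx /cofactor.
(* Cofactors along row [i] delete the only row in which the two matrices differ. *)
congr (_ * (_ * \det _)); apply/matrixP => k l.
by rewrite !mxE eq_sym (negbTE (neq_lift _ _)).
Qed.

Lemma normc_prod (R : rcfType) (I : Type) (r : seq I) (P : pred I)
    (F : I -> R[i]) :
  normc (\prod_(i <- r | P i) F i) = \prod_(i <- r | P i) normc (F i).
Proof. exact: (big_morph _ (@normcM R) (@normc1 R)). Qed.

Lemma ler_normc_sum (R : rcfType) (I : Type) (r : seq I) (P : pred I)
    (F : I -> R[i]) :
  normc (\sum_(i <- r | P i) F i) <= \sum_(i <- r | P i) normc (F i).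
Proof.
elim/big_ind2: _ => [|x a y b xa yb|//]; first by rewrite normc0.
by rewrite (le_trans (le_normcD _ _)) ?lerD.
Qed.

Lemma dV_vandermonde (R : realType) (n : nat) (z : (R[i] ^ n)%type) :
  dV z = normc (vandermonde z).
Proof.
by rewrite normc_prod; apply: eq_bigr => i _; rewrite normc_prod.
Qed.

(** The modulus absorbs the sign between the two orders of subtraction. In this form equal points
    give equal rows, and permuting the points permutes the rows, which costs only a sign. *)
Lemma dV_det (R : realType) (n : nat) (z : (R[i] ^ n)%type) :
  dV z = normc (\det (\matrix_(k < n, j < n) z k ^+ j)).
Proof.
have -> : \matrix_(k < n, j < n) z k ^+ j = (Vandermonde n (\row_k z k))^T.
  by apply/matrixP => k j; rewrite !mxE.
rewrite det_tr det_Vandermonde normc_prod; apply: eq_bigr => i _.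
rewrite normc_prod; apply: eq_bigr => j _.
by rewrite !mxE -normcN opprB.
Qed.

Lemma dV_pseudo_nmetric (R : realType) (n : nat) :
  (0 < n)%N -> pseudo_nmetric (@dV R n).
Proof.
move=> n_gt0; split => [z i j /eqP ij zij | z s | z y].
- rewrite dV_det (determinant_alternate ij) ?normc0 // => k.
  by rewrite !mxE zij.
- rewrite !dV_det.
  have -> : \matrix_(k < n, j < n) [ffun k => z (s k)] k ^+ j
            = perm_mx s *m \matrix_(k < n, j < n) z k ^+ j.
    by rewrite -row_permE; apply/matrixP => k j; rewrite !mxE ffunE.
  rewrite det_mulmx det_perm normcM; case: (odd_perm s).
    by rewrite expr1 normcN normc1 mul1r.
  by rewrite expr0 normc1 mul1r.
(* The constant column is that of the zeroth powers, of index [Ordinal n_gt0]. *)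
- rewrite dV_det -(@sum_det_replace_row _ _ _ (\row_j y ^+ j) (Ordinal n_gt0));
    [| by rewrite mxE | by move=> k; rewrite mxE].
  apply: le_trans (ler_normc_sum _ _ _) _; apply: ler_sum => i _.
  have <- : \matrix_(k < n, j < n) replace_at z i y k ^+ j =
      \matrix_(k, j) if k == i then (\row_j y ^+ j) 0 j
                     else (\matrix_(k, j) z k ^+ j) k j.
    by apply/matrixP => k j; rewrite !mxE ffunE; case: ifP.
  by rewrite dV_det.
Qed.

Lemma dV_nmetric (R : realType) (n : nat) : (0 < n)%N -> nmetric (@dV R n).
Proof.
move=> n_gt0; split; first exact: dV_pseudo_nmetric.
(* A vanishing product has a vanishing factor, and its indices differ because [i < j]. *)
move=> z /eqP/prodf_eq0 [i _ /prodf_eq0 [j ij /eqP/eq0_normc/eqP]].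
rewrite subr_eq0 => /eqP zij; exists i, j; split=> // eij.
by rewrite eij ltnn in ij.
Qed.

(** Used for the embedding of the reals into [R[i]]. Replacing a point commutes with applying [f],
    and injectivity brings a coincidence of images back to [Y]. *)
Lemma nmetric_pullback (R : realType) (X Y : Type) (n : nat) (f : Y -> X)
    (d : (X ^ n)%type -> R) :
  injective f -> nmetric d ->
  nmetric (fun y : (Y ^ n)%type => d [ffun k => f (y k)]).
Proof.
move=> f_inj [[d0 dS dle] d_def]; split; first split.
- by move=> y i j ij yij; apply: (d0 _ i j ij); rewrite !ffunE yij.
- move=> y s; rewrite -[RHS](dS _ s); congr d.
  by apply/ffunP => k; rewrite !ffunE.
- move=> y t; apply: le_trans (dle _ (f t)) _; apply: ler_sum => i _.
  have -> // : replace_at [ffun k => f (y k)] i (f t) =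
               [ffun k => f (replace_at y i t k)].
  by apply/ffunP => k; rewrite !ffunE; case: ifP.
- move=> y /d_def [i [j [ij]]]; rewrite !ffunE => /f_inj yij.
  by exists i, j.
Qed.

Theorem theorem2p3 (R : realType) (n : nat) (hn : (2 <= n)%N) :
  [/\ forall z : (R[i] ^ n)%type, dV z = ComplexField.Normc.normc (vandermonde z),
      nmetric (@dV R n)
    & nmetric (real_restriction (@dV R n))].
Proof.
have n_gt0 : (0 < n)%N by apply: ltnW.
split; [exact: dV_vandermonde | exact: dV_nmetric |].
by apply: nmetric_pullback (@dV_nmetric R n n_gt0); apply: complexI.
Qed.
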